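(* Let $n\ge 1$ be an integer, let $P(z)$ be a polynomial of degree $n$ with complex coefficients, and let $Q(z)=z^n\overline{P(1/\bar z)}$. Then for every real $R\ge 1$ and every $z\in\mathbb{C}$ with $|z|\ge 1$, $$|R\,P'(Rz)-P'(z)|+|R\,Q'(Rz)-Q'(z)|\le n(R^n-1)|z|^{n-1}\max_{|w|=1}|P(w)|.$$ Equality holds for $P(z)=\lambda z^n$, $\lambda\ne 0$.
   Context: $Q$ is regarded as a polynomial: if $P(z)=\sum_{k=0}^n a_kz^k$ then $Q(z)=\sum_{k=0}^n\overline{a_k}z^{n-k}$. $P'(Rz)$ denotes the derivative $P'$ evaluated at the point $Rz$, and similarly for $Q'(Rz)$. *)

(* Defs.v *)
From mathcomp Require Import all_boot all_order all_algebra.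
From mathcomp Require Import complex.
From mathcomp Require Import all_classical all_reals all_analysis.
Set Implicit Arguments.
Unset Strict Implicit.
Unset Printing Implicit Defensive.
Import Order.TTheory GRing.Theory Num.Theory.
Import numFieldNormedType.Exports.
Local Open Scope classical_set_scope.
Local Open Scope complex_scope.
Local Open Scope ring_scope.

(* The polynomial z^n * conj (P (1 / conj z)), for P of degree at most n; see
   [conj_reciprocalE]. *)
Definition conj_reciprocal (R : realType) (n : nat) (P : {poly R[i]}) :
    {poly R[i]} :=
  \sum_(k < n.+1) (P`_k)^* *: 'X^(n - k).

(* [`|w|] and [`|P.[w]|] have type [R[i]] (with zero imaginary part), hence the
   projection to [R]. The supremum is attained: see [circle_max_attained]. *)
Definition circle_max (R : realType) (P : {poly R[i]}) : R :=
  sup [set complex.Re `|P.[w]| | w in [set w : R[i] | `|w| = 1]].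

Lemma conj_reciprocalE (R : realType) (n : nat) (P : {poly R[i]}) (z : R[i]) :
  (size P <= n.+1)%N -> z != 0 ->
  (conj_reciprocal n P).[z] = z ^+ n * (P.[(z^*)^-1])^*.
Proof.
move=> sP z0; rewrite /conj_reciprocal horner_sum (horner_coef_wide _ sP).
rewrite rmorph_sum mulr_sumr; apply: eq_bigr => k _.
rewrite hornerZ hornerXn rmorphM rmorphXn fmorphV /= conjCK mulrCA; congr (_ * _).
by rewrite exprVn -expfB_cond ?(negPf z0) ?add0n // -ltnS.
Qed.

Lemma horner_Re_Im_continuous (R : realType) (P : {poly R[i]}) (u v : R -> R) :
  continuous u -> continuous v ->
  continuous (fun x => complex.Re P.[u x +i* v x]) /\
  continuous (fun x => complex.Im P.[u x +i* v x]).
Proof.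
move=> cu cv; elim/poly_ind: P => [|P c [IHr IHi]].
  by split; rewrite (_ : (fun _ => _) = cst 0);
    [exact: cst_continuous| |exact: cst_continuous|];
    apply/funext => x; rewrite horner0.
split.
- rewrite (_ : (fun _ => _) = fun x => complex.Re P.[u x +i* v x] * u x
    - complex.Im P.[u x +i* v x] * v x + complex.Re c); last first.
    by apply/funext => y; rewrite hornerMXaddC; case: (P.[_]) => a b; case: c.
  move=> x; apply: cvgD; last exact: cvg_cst.
  by apply: cvgB; apply: cvgM; [exact: IHr|exact: cu|exact: IHi|exact: cv].
- rewrite (_ : (fun _ => _) = fun x => complex.Re P.[u x +i* v x] * v x
    + complex.Im P.[u x +i* v x] * u x + complex.Im c); last first.
    by apply/funext => y; rewrite hornerMXaddC; case: (P.[_]) => a b; case: c.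
  move=> x; apply: cvgD; last exact: cvg_cst.
  by apply: cvgD; apply: cvgM; [exact: IHr|exact: cv|exact: IHi|exact: cu].
Qed.

Lemma circle_max_attained (R : realType) (P : {poly R[i]}) :
  (exists2 w : R[i], `|w| = 1 & `|P.[w]| = (circle_max P)%:C) /\
  (forall w : R[i], `|w| = 1 -> `|P.[w]| <= (circle_max P)%:C).
Proof.
pose c (w : R[i]) : R := complex.Re `|P.[w]|.
have cE w : `|P.[w]| = (c w)%:C by rewrite /c normc_def.
pose e (s : R) x := x +i* (s * Num.sqrt (1 - x ^+ 2)).
have cc s : continuous (fun x => c (e s x)).
  have cu : continuous (fun x : R => x) by move=> x; exact: cvg_id.
  have cv : continuous (fun x : R => s * Num.sqrt (1 - x ^+ 2)).
    move=> x; apply: cvgM; first exact: cvg_cst.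
    apply: (@continuous_comp _ _ _ (fun x : R => 1 - x ^+ 2) Num.sqrt);
      last exact: sqrt_continuous.
    apply: cvgB; first exact: cvg_cst.
    exact: exprn_continuous.
  have [hr hi] := horner_Re_Im_continuous P cu cv.
  rewrite (_ : (fun _ => _) = fun x => Num.sqrt (complex.Re P.[e s x] ^+ 2 +
    complex.Im P.[e s x] ^+ 2)); last by apply/funext => y; rewrite /c normc_def.
  move=> x; apply: (@continuous_comp _ _ _ (fun x : R => _ + _) Num.sqrt);
    last exact: sqrt_continuous.
  apply: cvgD; rewrite expr2; under eq_fun do rewrite expr2.
  - by apply: cvgM; exact: hr.
  - by apply: cvgM; exact: hi.
have maxP s : exists2 m, m \in `[(-1 : R), 1] &
    forall t, t \in `[(-1 : R), 1] -> c (e s t) <= c (e s m).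
  apply: EVT_max; first exact: le_trans (lerN10 R) ler01.
  by apply: continuous_subspaceT; exact: cc.
have e1 s x : s ^+ 2 = 1 -> x \in `[(-1 : R), 1] -> `|e s x| = 1.
  move=> s1; rewrite in_itv /= -ler_norml => x1.
  rewrite normc_def /= exprMn s1 mul1r sqr_sqrtr ?subrKC ?sqrtr1//.
  by rewrite subr_ge0 -real_normK ?num_real// expr_le1.
have surj (w : R[i]) : `|w| = 1 -> exists2 s : R, s ^+ 2 = 1 &
    exists2 x, x \in `[(-1 : R), 1] & w = e s x.
  case: w => a b; rewrite normc_def /= => -[] ab1.
  have {}ab1 : a ^+ 2 + b ^+ 2 = 1.
    by rewrite -[LHS]sqr_sqrtr ?addr_ge0 ?sqr_ge0// ab1 expr1n.
  have ha : a \in `[(-1 : R), 1].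
    rewrite in_itv /= -ler_norml -(@expr_le1 _ 2)// real_normK ?num_real//.
    by rewrite -ab1 lerDl sqr_ge0.
  have hb : Num.sqrt (1 - a ^+ 2) = `|b| by rewrite -ab1 addrC addKr sqrtr_sqr.
  have [b0|b0] := leP 0 b.
    by exists 1; rewrite ?expr1n//; exists a; rewrite // /e hb ger0_norm ?mul1r.
  exists (-1); rewrite ?sqrrN ?expr1n//; exists a => //.
  by rewrite /e hb ltr0_norm// mulN1r opprK.
have [w w1 wmax] : exists2 w, `|w| = 1 & forall t, `|t| = 1 -> c t <= c w.
  have [p hp pm] := maxP 1; have [q hq qm] := maxP (-1).
  have sgn s : s ^+ 2 = 1 -> s = 1 \/ s = -1 :> R.
    by move/eqP; rewrite sqrf_eq1 => /orP[]/eqP; [left|right].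
  have [pq|/ltW pq] := leP (c (e 1 p)) (c (e (-1) q)).
  - exists (e (-1) q); first by apply: e1; rewrite ?sqrrN ?expr1n.
    move=> t /surj[s /sgn[]-> [x hx ->]]; last exact: qm.
    exact: le_trans (pm _ hx) pq.
  - exists (e 1 p); first by apply: e1; rewrite ?expr1n.
    move=> t /surj[s /sgn[]-> [x hx ->]]; first exact: pm.
    exact: le_trans (qm _ hx) pq.
have maxE : circle_max P = c w.
  apply/eqP; rewrite eq_le; apply/andP; split.
  - by apply: ge_sup; [exists (c w), w|move=> _ [t t1 <-]; exact: wmax].
  - apply: ub_le_sup; last by exists w.
    by exists (c w) => _ [t t1 <-]; exact: wmax.
split; first by exists w; rewrite // maxE cE.
by move=> t t1; rewrite maxE cE lecR wmax.
Qed.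

(* Main.v *)
Require Import Defs.
From mathcomp Require Import all_boot all_order all_algebra.
From mathcomp Require Import all_solvable separable cyclotomic.
From mathcomp Require Import complex.
From mathcomp Require Import zify ring.
From mathcomp Require Import all_classical all_reals all_analysis.
Set Implicit Arguments.
Unset Strict Implicit.
Unset Printing Implicit Defensive.
Import Order.TTheory GRing.Theory Num.Theory.
Local Open Scope complex_scope.
Local Open Scope ring_scope.

(** Multiplying the two differences by z turns them into coefficient sums.
    Write z = |z| u with |u| = 1, and let a_k be the coefficients of P. With
    d_k = k (r^k - 1) |z|^k, the first becomes the sum of the d_k a_k u^k and
    the second, up to conjugation and a unimodular factor, the sum of the
    d_(n-k) a_k u^k. So the inequality follows from a statement on multipliers
    ([norm_convex_pair_le]): if d is convex with d_0 = 0 and nonnegative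
    increments, then

      |sum_k d_k a_k| + |sum_k d_(n-k) a_k| <= d_n max_(|w| = 1) |P(w)|.

    A convex sequence d with d_0 = 0 is a nonnegative combination of ramps
    k |-> max(k - t, 0) ([nonneg_convex_ramps]), and both sides of the estimate
    are respectively subadditive and linear in d, so only ramps matter. For a
    ramp of height s = n - t, choose a unimodular v that aligns the two sums, so
    that the left-hand side is the modulus of the sum of the
    (max(s - k, 0) + v max(s - (n - k), 0)) a_k. This linear functional of P is
    a positive quadrature ([fejer_quadrature]): its nodes x_j are the n roots of
    x^n = v and its weights are the Fejer kernel values
    |1 + x_j + ... + x_j^(s-1)|^2 / n. Since the weights are nonnegative and
    have total mass s, the functional is at most s max |P| on the unit circle.

    The sequence d used here is convex because nonnegative nondecreasing convex
    sequences are stable under products. *)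

(** * Power sums over the roots of x^n = v *)

Lemma closed_prim_root_exists (C : numClosedFieldType) n :
  (0 < n)%N -> exists w : C, n.-primitive_root w.
Proof.
move=> n_gt0; pose p : {poly C} := 'X^n - 1.
have [rs] := closed_field_poly_normal p.
rewrite (monicP _) ?monicXnsubC // scale1r => Dp.
have rn1 : all n.-unity_root rs.
  by apply/allP => x; rewrite -root_prod_XsubC -Dp.
have sz_rs : (n < (size rs).+1)%N.
  by rewrite -(size_prod_XsubC rs id) -Dp size_XnsubC.
have [|w _ wn] := hasP (has_prim_root n_gt0 rn1 _ sz_rs); last by exists w.
by rewrite -separable_prod_XsubC -Dp separable_Xn_sub_1 // pnatr_eq0 -lt0n.
Qed.

Lemma sum_prim_root_exp (F : fieldType) n (w : F) q :
  n.-primitive_root w ->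
  \sum_(j < n) (w ^+ j) ^+ q = if (n %| q)%N then n%:R else 0.
Proof.
move=> wn; have expE (j : 'I_n) : (w ^+ j) ^+ q = (w ^+ q) ^+ j.
  by rewrite -!exprM mulnC.
under eq_bigr do rewrite expE.
rewrite (prim_order_dvd wn); have [->|wq_neq1] := eqVneq (w ^+ q) 1.
  under eq_bigr do rewrite expr1n.
  by rewrite sumr_const card_ord.
apply: (@mulfI _ (w ^+ q - 1)); first by rewrite subr_eq0.
by rewrite -subrX1 mulr0 -exprM mulnC exprM (prim_expr_order wn) expr1n subrr.
Qed.

(** The nodes are the roots of x^n = v. On the unit circle the summand is
    x^(p - l), whose average over these roots is nonzero only when n divides
    p - l; the bounds on l and p leave the exponents 0 and n. *)
Lemma unimodular_moments (C : numClosedFieldType) n (v : C) :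
  (0 < n)%N -> `|v| = 1 ->
  exists x : 'I_n -> C, (forall j, `|x j| = 1) /\
    forall l p, (l < n)%N -> (p < l + n.*2)%N ->
      \sum_j ((x j)^* ^+ l * x j ^+ p) =
      n%:R * ((p == l)%:R + v * (p == l + n)%:R).
Proof.
move=> n_gt0 v1; have [u un] := closed_prim_root_exists C n_gt0.
pose c := n.-root v.
have cn : c ^+ n = v by rewrite rootCK.
have c1 : `|c| = 1 by rewrite norm_rootC v1 rootC1.
have u1 : `|u| = 1.
  apply/eqP; rewrite -(@pexpr_eq1 _ _ n) // -normrX.
  by rewrite (prim_expr_order un) normr1.
have sumE q :
    \sum_(j < n) (c * u ^+ j) ^+ q = if (n %| q)%N then n%:R * c ^+ q else 0.
  under eq_bigr do rewrite exprMn.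
  rewrite -mulr_sumr (sum_prim_root_exp _ un).
  by case: ifP => _; rewrite ?mulr0 // mulrC.
have x1 (j : 'I_n) : `|c * u ^+ j| = 1.
  by rewrite normrM normrX c1 u1 expr1n mulr1.
exists (fun j => c * u ^+ j); split=> // l p ln pln.
have xx (j : 'I_n) : (c * u ^+ j)^* * (c * u ^+ j) = 1.
  by rewrite -normCKC x1 expr1n.
have [lp|pl] := leqP l p.
  have [d pE] : exists d, p = (l + d)%N by exists (p - l)%N; lia.
  rewrite {p}pE in pln lp *.
  under eq_bigr => j _ do rewrite exprD mulrA -exprMn xx expr1n mul1r.
  rewrite sumE -{2}[l in X in X%:R + _]addn0 !eqn_add2l.
  have [->|d0] := eqVneq d 0%N.
    by rewrite dvdn0 expr0 (ltn_eqF n_gt0) !(mulr0, addr0).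
  have [->|dn] := eqVneq d n; first by rewrite dvdnn cn add0r mulr1.
  case: ifP => [/dvdnP[k dE]|_]; last by rewrite !(mulr0, addr0).
  by case: k dE => [|[|k]] dE; exfalso; nia.
have [d lE] : exists d, l = (p + d)%N by exists (l - p)%N; lia.
have conjE (j : 'I_n) : (c * u ^+ j)^* ^+ l * (c * u ^+ j) ^+ p =
    ((c * u ^+ j) ^+ d)^*.
  by rewrite lE exprD mulrAC -exprMn xx expr1n mul1r rmorphXn.
under eq_bigr do rewrite conjE.
rewrite -rmorph_sum sumE.
rewrite [(n %| d)%N]gtnNdvd; [|lia|lia].
have -> : (p == l) = false by lia.
have -> : (p == l + n)%N = false by lia.
by rewrite rmorph0 !(mulr0, addr0).
Qed.

(** * The Fejer quadrature and the estimate for ramps *)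

Lemma count_shifted_diag s c :
  (\sum_(a < s) \sum_(b < s) (b == a + c :> nat) = s - c)%N.
Proof.
have inner (a : 'I_s) : (\sum_(b < s) (b == a + c :> nat) = (a < s - c))%N.
  rewrite -big_mkcond /= (big_ord1_eq _ (fun=> 1%N)) -ltn_subRL.
  by rewrite ltn_subRL addnC -ltn_subRL; case: ltnP.
under eq_bigr do rewrite inner.
rewrite -big_mkcond -(big_ord_widen _ (fun=> 1%N)) ?leq_subr //.
by rewrite sum_nat_const card_ord muln1.
Qed.

(** The weights are Fejer kernel values |1 + x + ... + x^(s-1)|^2 / n at the
    roots of x^n = v. Expanding the square, the k-th coefficient of the
    quadrature counts pairs (i, l) of exponents below s with k + i = l, which
    gives s - k, and with k + i = l + n, which gives s - (n - k) and a factor v.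
    The subtractions are truncated: both counts vanish once the shift reaches
    s. *)
Lemma fejer_quadrature (C : numClosedFieldType) n s (v : C) :
  (s <= n)%N -> (0 < n)%N -> `|v| = 1 ->
  exists (x : 'I_n -> C) (e : 'I_n -> C),
    [/\ forall j, `|x j| = 1, forall j, 0 <= e j &
     forall a : nat -> C,
       \sum_j e j * (\sum_(k < n.+1) a k * x j ^+ k) =
       \sum_(k < n.+1) ((s - k)%:R + v * (s - (n - k))%:R) * a k].
Proof.
move=> sn n_gt0 v1; have [x [x1 xE]] := unimodular_moments n_gt0 v1.
pose S j := \sum_(i < s) x j ^+ i.
exists x, (fun j => n%:R^-1 * `|S j| ^+ 2); split=> [//|j|a].
  by rewrite mulr_ge0 ?invr_ge0 ?ler0n ?exprn_ge0.
have SE j k : `|S j| ^+ 2 * x j ^+ k =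
    \sum_(i < s) \sum_(l < s) (x j)^* ^+ l * x j ^+ (i + k).
  rewrite normCK rmorph_sum mulr_suml mulr_suml; apply: eq_bigr => i _.
  rewrite mulr_sumr mulr_suml; apply: eq_bigr => l _.
  by rewrite rmorphXn exprD; ring.
under eq_bigr do rewrite mulr_sumr.
rewrite exchange_big; apply: eq_bigr => k _ /=.
have termE j : n%:R^-1 * `|S j| ^+ 2 * (a k * x j ^+ k) =
    n%:R^-1 * (\sum_(i < s) \sum_(l < s) (x j)^* ^+ l * x j ^+ (i + k)) * a k.
  by rewrite -SE; ring.
under eq_bigr do rewrite termE.
rewrite -mulr_suml -mulr_sumr; congr (_ * _).
rewrite exchange_big /=; under eq_bigr do rewrite exchange_big /=.
have kn := ltn_ord k.
have momentE (i l : 'I_s) : \sum_j ((x j)^* ^+ l * x j ^+ (i + k)) =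
    n%:R * ((l == (i + k)%N :> nat)%:R + v * (i == (l + (n - k))%N :> nat)%:R).
  have i_lt := ltn_ord i; have l_lt := ltn_ord l.
  rewrite xE; [|lia|lia].
  have -> : (i + k == l + n)%N = (i == l + (n - k) :> nat)%N by lia.
  by rewrite eq_sym.
under eq_bigr => i _ do under eq_bigr => l _ do rewrite momentE.
under eq_bigr => i _ do rewrite -mulr_sumr big_split -mulr_sumr -!natr_sum /=.
rewrite -mulr_sumr mulrA mulVf ?pnatr_eq0 -?lt0n // mul1r.
rewrite big_split -mulr_sumr -!natr_sum /= count_shifted_diag.
by rewrite exchange_big /= count_shifted_diag.
Qed.

Lemma norm_add_align (C : numClosedFieldType) (A B : C) :
  exists2 v, `|v| = 1 & `|A| + `|B| = `|A + v * B|.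
Proof.
have [->|A0] := eqVneq A 0.
  by exists 1; rewrite ?normr1 // mul1r normr0 !add0r.
have [->|B0] := eqVneq B 0.
  by exists 1; rewrite ?normr1 // mulr0 normr0 !addr0.
have nA0 : `|A| != 0 by rewrite normr_eq0.
have nB0 : `|B| != 0 by rewrite normr_eq0.
exists (A / `|A| * (`|B| / B)).
  by rewrite !normrM !normfV !normr_id divff // mul1r divff.
have -> : A + A / `|A| * (`|B| / B) * B = A / `|A| * (`|A| + `|B|).
  by field; rewrite nA0.
by rewrite !normrM normfV normr_id divff // mul1r ger0_norm // addr_ge0.
Qed.

(** After the two sums are aligned by a unimodular v, the left-hand side is the
    modulus of a positive quadrature of total mass s, applied to a polynomial
    bounded by M on the unit circle. *)
Lemma norm_ramp_pair_le (C : numClosedFieldType) n s (a : nat -> C) (M : C) :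
  (s <= n)%N ->
  (forall w : C, `|w| = 1 -> `|\sum_(k < n.+1) a k * w ^+ k| <= M) ->
  `|\sum_(k < n.+1) (s - (n - k))%:R * a k| +
    `|\sum_(k < n.+1) (s - k)%:R * a k| <= s%:R * M.
Proof.
move=> sn aM; have [n0|n_gt0] := posnP n.
  have -> : s = 0%N by lia.
  rewrite !big1 ?normr0 ?addr0 ?mul0r // => k _.
  by rewrite sub0n mul0r.
rewrite addrC.
have [v v1 ->] := norm_add_align (\sum_(k < n.+1) (s - k)%:R * a k)
  (\sum_(k < n.+1) (s - (n - k))%:R * a k).
have [x [e [x1 e0 quad]]] := fejer_quadrature sn n_gt0 v1.
(* The constant polynomial 1 reads off the mass; s <= n kills the v-term. *)
have mass : \sum_j e j = s%:R.
  have := quad (fun k => (k == 0%N)%:R).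
  rewrite [RHS]big_ord_recl [X in _ = _ + X]big1 => [|k _]; last by rewrite mulr0.
  rewrite addr0 mulr1 subn0 subn0.
  have -> : (s - n = 0)%N by lia.
  rewrite mulr0 addr0 => <-; apply: eq_bigr => j _.
  rewrite big_ord_recl big1 => [|k _]; last by rewrite mul0r.
  by rewrite addr0 !mulr1.
have -> : \sum_(k < n.+1) (s - k)%:R * a k +
    v * (\sum_(k < n.+1) (s - (n - k))%:R * a k) =
    \sum_j e j * (\sum_(k < n.+1) a k * x j ^+ k).
  rewrite quad mulr_sumr -big_split; apply: eq_bigr => k _ /=.
  by rewrite mulrDl mulrA.
rewrite -mass mulr_suml; apply: le_trans (ler_norm_sum _ _ _) _.
by apply: ler_sum => j _; rewrite normrM ger0_norm // ler_wpM2l // aM.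
Qed.

(** * Nonnegative convex sequences *)

Definition nonneg_nondecr (C : numDomainType) (f : nat -> C) :=
  0 <= f 0%N /\ forall k, f k <= f k.+1.

(** Convexity together with nonnegative values and increments: convexity alone
    would not be stable under products. *)
Definition nonneg_convex (C : numDomainType) (f : nat -> C) :=
  0 <= f 0%N /\ nonneg_nondecr (fun k => f k.+1 - f k).

Lemma nonneg_nondecr_ge0 (C : numDomainType) (f : nat -> C) k :
  nonneg_nondecr f -> 0 <= f k.
Proof. by case=> f0 fS; elim: k => // k IH; apply: le_trans IH (fS k). Qed.

Lemma nonneg_nondecrD (C : numDomainType) (f g : nat -> C) :
  nonneg_nondecr f -> nonneg_nondecr g -> nonneg_nondecr (fun k => f k + g k).
Proof.
by move=> [f0 fS] [g0 gS]; split=> [|k]; [apply: addr_ge0|apply: lerD].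
Qed.

Lemma nonneg_nondecrM (C : numDomainType) (f g : nat -> C) :
  nonneg_nondecr f -> nonneg_nondecr g -> nonneg_nondecr (fun k => f k * g k).
Proof.
move=> cf cg; have [f0 fS] := cf; have [g0 gS] := cg.
by split=> [|k]; [apply: mulr_ge0|apply: ler_pM => //; exact: nonneg_nondecr_ge0].
Qed.

Lemma nonneg_convex_nondecr (C : numDomainType) (f : nat -> C) :
  nonneg_convex f -> nonneg_nondecr f.
Proof.
case=> f0 cf; split=> // k; rewrite -subr_ge0.
exact: (nonneg_nondecr_ge0 k cf).
Qed.

(** The increment of a product is (f(k+1) - f(k)) g(k+1) + f(k) (g(k+1) - g(k)),
    where all four factors are nonnegative and nondecreasing. *)
Lemma nonneg_convexM (C : numDomainType) (f g : nat -> C) :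
  nonneg_convex f -> nonneg_convex g -> nonneg_convex (fun k => f k * g k).
Proof.
move=> cf cg.
have nf := nonneg_convex_nondecr cf; have ng := nonneg_convex_nondecr cg.
have [f0 df] := cf; have [g0 dg] := cg.
split; first exact: mulr_ge0.
have ngS : nonneg_nondecr (fun k => g k.+1).
  by split=> [|k]; [exact: (nonneg_nondecr_ge0 1 ng)|case: ng].
have [h0 hS] := nonneg_nondecrD (nonneg_nondecrM df ngS) (nonneg_nondecrM nf dg).
have E k : f k.+1 * g k.+1 - f k * g k =
    (f k.+1 - f k) * g k.+1 + f k * (g k.+1 - g k) by ring.
by split=> [|k]; rewrite !E.
Qed.

Lemma nonneg_convex_nat (C : numDomainType) : nonneg_convex (fun k => k%:R : C).
Proof.
have E k : k.+1%:R - k%:R = 1 :> C by rewrite -natrB ?subSnn.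
by split=> //; split=> [|k]; rewrite !E ?ler01.
Qed.

Lemma nonneg_convex_exp (C : numDomainType) (x : C) :
  1 <= x -> nonneg_convex (fun k => x ^+ k).
Proof.
move=> x1; have x0 : 0 <= x := le_trans ler01 x1.
have E k : x ^+ k.+1 - x ^+ k = x ^+ k * (x - 1) by rewrite exprSr; ring.
split; first by rewrite expr0 ler01.
split=> [|k]; rewrite !E ?mulr_ge0 ?exprn_ge0 ?subr_ge0 //.
by rewrite ler_wpM2r ?subr_ge0 // exprS ler_peMl ?exprn_ge0.
Qed.

Lemma nonneg_convexB1 (C : numDomainType) (f : nat -> C) :
  1 <= f 0%N -> nonneg_convex f -> nonneg_convex (fun k => f k - 1).
Proof.
move=> f1 [_ [d0 dS]]; split; first by rewrite subr_ge0.
have E k : f k.+1 - 1 - (f k - 1) = f k.+1 - f k by ring.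
by split=> [|k]; rewrite !E.
Qed.

(** The weight of the ramp starting at t is the second difference of d at t,
    and the first increment of d when t = 0. *)
Lemma nonneg_convex_ramps (C : numDomainType) n (d : nat -> C) :
  d 0%N = 0 -> nonneg_convex d ->
  exists2 e : nat -> C, forall t, 0 <= e t &
    forall k, (k <= n)%N -> d k = \sum_(t < n) e t * (k - t)%:R.
Proof.
move=> d00 [_ [D0 DS]].
pose D k := d k.+1 - d k.
pose e t := if t is t'.+1 then D t'.+1 - D t' else D 0%N.
exists e; first by case=> [|t] //=; rewrite subr_ge0 DS.
have sum_e k : \sum_(t < k.+1) e t = D k.
  elim: k => [|k IH]; first by rewrite big_ord_recl big_ord0 addr0.
  by rewrite big_ord_recr /= IH /D; ring.
elim=> [_|k IH kn].
  by rewrite d00 big1 // => t _; rewrite sub0n mulr0.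
have -> : d k.+1 = d k + D k by rewrite /D; ring.
rewrite -sum_e IH ?(ltnW kn) // (big_ord_widen n) //.
rewrite [X in _ + X]big_mkcond -big_split.
apply: eq_bigr => t _ /=; case: ltnP => tk.
  by rewrite subSn // -natr1 mulrDr mulr1.
have -> : (k - t = 0)%N by lia.
have -> : (k.+1 - t = 0)%N by lia.
by rewrite addr0.
Qed.

(** Decomposing d into ramps reduces this to [norm_ramp_pair_le]: read from the
    other end, the ramp that starts at t has height n - t, and d n is the sum of
    the weights times these heights. *)
Lemma norm_convex_pair_le (C : numClosedFieldType) n (d a : nat -> C) (M : C) :
  d 0%N = 0 -> nonneg_convex d ->
  (forall w : C, `|w| = 1 -> `|\sum_(k < n.+1) a k * w ^+ k| <= M) ->
  `|\sum_(k < n.+1) d k * a k| + `|\sum_(k < n.+1) d (n - k)%N * a k|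
    <= d n * M.
Proof.
move=> d0 dc aM; have [e e0 dE] := nonneg_convex_ramps n d0 dc.
have sumE (f : nat -> nat) : (forall k, k < n.+1 -> f k <= n)%N ->
    \sum_(k < n.+1) d (f k) * a k =
    \sum_(t < n) e t * \sum_(k < n.+1) (f k - t)%:R * a k.
  move=> fn; under [RHS]eq_bigr do rewrite mulr_sumr.
  rewrite exchange_big; apply: eq_bigr => k _ /=.
  rewrite dE ?fn // mulr_suml; apply: eq_bigr => t _.
  by rewrite mulrA.
rewrite (sumE id) // (sumE (subn n)); last by move=> k _; exact: leq_subr.
have lin (b : nat -> C) :
    `|\sum_(t < n) e t * b t| <= \sum_(t < n) e t * `|b t|.
  apply: le_trans (ler_norm_sum _ _ _) _.
  by apply: ler_sum => t _; rewrite normrM ger0_norm.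
apply: le_trans (lerD (lin (fun t => \sum_(k < n.+1) (k - t)%:R * a k))
  (lin (fun t => \sum_(k < n.+1) (n - k - t)%:R * a k))) _.
rewrite -big_split dE // mulr_suml; apply: ler_sum => t _ /=.
rewrite -mulrDr -mulrA ler_wpM2l //.
have tn := ltn_ord t.
have up : \sum_(k < n.+1) (n - t - (n - k))%:R * a k =
    \sum_(k < n.+1) (k - t)%:R * a k.
  apply: eq_bigr => k _; have kn := ltn_ord k.
  by have -> : (n - t - (n - k) = k - t)%N by lia.
have down : \sum_(k < n.+1) (n - t - k)%:R * a k =
    \sum_(k < n.+1) (n - k - t)%:R * a k.
  by apply: eq_bigr => k _; rewrite subnAC.
by rewrite -up -down; exact: norm_ramp_pair_le (leq_subr t n) aM.
Qed.

(** * The differences of dilated derivatives *)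

Lemma mulX_deriv_horner (C : comNzRingType) n (p : {poly C}) z :
  (size p <= n.+1)%N ->
  z * p^`().[z] = \sum_(k < n.+1) k%:R * p`_k * z ^+ k.
Proof.
move=> sp; have sd : (size p^`() <= n)%N.
  by apply: leq_trans (size_poly _ _) _; case: (size p) sp.
rewrite (horner_coef_wide _ sd) mulr_sumr [RHS]big_ord_recl !mul0r add0r.
by apply: eq_bigr => k _; rewrite lift0 coef_deriv exprS -mulr_natl; ring.
Qed.

Lemma mulX_dilation_deriv (C : comNzRingType) n (p : {poly C}) r z :
  (size p <= n.+1)%N ->
  z * (r * p^`().[r * z] - p^`().[z]) =
  \sum_(k < n.+1) k%:R * (r ^+ k - 1) * (p`_k * z ^+ k).
Proof.
move=> sp; rewrite mulrBr mulrA [z * r]mulrC !(mulX_deriv_horner _ sp).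
by rewrite -sumrB; apply: eq_bigr => k _; rewrite exprMn; ring.
Qed.

Lemma dilation_deriv_monomial (C : comNzRingType) n (c r z : C) :
  (0 < n)%N ->
  r * (c *: 'X^n)^`().[r * z] - (c *: 'X^n)^`().[z] =
  n%:R * (r ^+ n - 1) * z ^+ n.-1 * c.
Proof.
move=> n_gt0; rewrite derivZ derivXn !hornerZ !hornerMn !hornerXn exprMn.
have -> : r ^+ n = r * r ^+ n.-1 by rewrite -exprS prednK.
by rewrite -(mulr_natl (_ * _)) -(mulr_natl (z ^+ _)); ring.
Qed.

(** The pair (P, Q) enters only through the symmetry of the coefficients. After
    multiplication by z, the term of P is the multiplier d_k = k (r^k - 1) |z|^k
    applied to the coefficients a_k of P(u X), where u = z / |z|; the term of Q
    is u^n times the conjugate of the reversed multiplier d_(n-k) applied to the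
    same a_k. *)
Lemma dilation_deriv_pair_le (C : numClosedFieldType) n (P Q : {poly C})
    (r z M : C) :
  (size P <= n.+1)%N -> (size Q <= n.+1)%N ->
  (forall k, (k <= n)%N -> Q`_k = (P`_(n - k))^*) ->
  (forall w, `|w| = 1 -> `|P.[w]| <= M) ->
  1 <= r -> 1 <= `|z| ->
  `|r * P^`().[r * z] - P^`().[z]| + `|r * Q^`().[r * z] - Q^`().[z]|
    <= n%:R * (r ^+ n - 1) * `|z| ^+ n.-1 * M.
Proof.
move=> sP sQ QP PM r1 z1.
have nz_gt0 : 0 < `|z| := lt_le_trans ltr01 z1.
have nz0 : `|z| != 0 by rewrite gt_eqF.
set rho := `|z|; pose u := z / rho.
have zE : z = rho * u by rewrite /u mulrC divfK.
have u1 : `|u| = 1 by rewrite /u normrM normfV /rho normr_id divff.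
have uuC : u * u^* = 1 by rewrite -normCK u1 expr1n.
pose d k : C := k%:R * (r ^+ k - 1) * rho ^+ k.
have dc : nonneg_convex d.
  apply: nonneg_convexM; last exact: nonneg_convex_exp.
  apply: nonneg_convexM; first exact: nonneg_convex_nat.
  by apply: nonneg_convexB1; [rewrite expr0|exact: nonneg_convex_exp].
have d0 : d 0%N = 0 by rewrite /d !mul0r.
pose a k := P`_k * u ^+ k.
have aM w : `|w| = 1 -> `|\sum_(k < n.+1) a k * w ^+ k| <= M.
  move=> w1; have := PM (u * w); rewrite normrM u1 w1 mulr1 => /(_ erefl).
  rewrite (horner_coef_wide _ sP).
  by under eq_bigr do rewrite exprMn mulrA.
have AE : z * (r * P^`().[r * z] - P^`().[z]) = \sum_(k < n.+1) d k * a k.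
  rewrite (mulX_dilation_deriv _ _ sP); apply: eq_bigr => k _.
  by rewrite /d /a {1}zE exprMn; ring.
have rconj : r^* = r by apply/CrealP; rewrite realE (le_trans ler01 r1).
have rhoconj : rho^* = rho by apply/CrealP; rewrite normr_real.
have BE : z * (r * Q^`().[r * z] - Q^`().[z]) =
    u ^+ n * (\sum_(k < n.+1) d (n - k)%N * a k)^*.
  rewrite (mulX_dilation_deriv _ _ sQ).
  rewrite rmorph_sum mulr_sumr [RHS](reindex_inj rev_ord_inj) /=.
  apply: eq_bigr => k _; have kn : (k <= n)%N by rewrite -ltnS.
  rewrite QP // subSS subKn // /d /a {1}zE exprMn.
  rewrite !rmorphM !rmorphB !rmorphXn rmorph1 rmorph_nat /= rconj rhoconj.
  have uk : u ^+ n * u^* ^+ (n - k) = u ^+ k.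
    by rewrite -[in u ^+ n](subnKC kn) exprD -mulrA -exprMn uuC expr1n mulr1.
  by rewrite -uk; ring.
rewrite -(ler_pM2l nz_gt0) mulrDr -!normrM AE BE normrM normrX u1 expr1n mul1r.
rewrite norm_conjC.
apply: le_trans (norm_convex_pair_le d0 dc aM) _.
rewrite /d; have [n0|n_gt0] := posnP n; first by rewrite n0 !mul0r mulr0.
have rhoE : rho ^+ n = rho * rho ^+ n.-1 by rewrite -exprS prednK.
by rewrite -/rho rhoE le_eqVlt; apply/orP; left; apply/eqP; ring.
Qed.

(** * The conjugate reciprocal polynomial *)

Lemma coef_conj_reciprocal (R : realType) n (P : {poly R[i]}) k :
  (k <= n)%N -> (conj_reciprocal n P)`_k = Num.conj P`_(n - k).
Proof.
move=> kn; rewrite /conj_reciprocal coef_sum.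
have lt : (n - k < n.+1)%N by lia.
rewrite (bigD1 (Ordinal lt)) //= big1 => [|j jk].
  by rewrite coefZ coefXn addr0 subKn // eqxx mulr1.
have jn := ltn_ord j; have {}jk : (j != n - k :> nat)%N by [].
by rewrite coefZ coefXn (_ : _ == _ = false) ?mulr0 //; lia.
Qed.

Lemma size_conj_reciprocal (R : realType) n (P : {poly R[i]}) :
  (size (conj_reciprocal n P) <= n.+1)%N.
Proof.
apply: leq_trans (size_sum _ _ _) _; apply/bigmax_leqP => k _.
apply: leq_trans (size_scale_leq _ _) _.
by rewrite size_polyXn ltnS leq_subr.
Qed.

Theorem corollary1 (R : realType) (n : nat) (hn : (1 <= n)%N) :
  (forall (P : {poly R[i]}), size P = n.+1 ->
   let Q := conj_reciprocal n P in
   forall (r : R) (z : R[i]), 1 <= r -> 1 <= `|z| ->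
     `|r%:C * P^`().[r%:C * z] - P^`().[z]|
       + `|r%:C * Q^`().[r%:C * z] - Q^`().[z]|
     <= n%:R * (r%:C ^+ n - 1) * `|z| ^+ n.-1 * (circle_max P)%:C)
  /\
  (forall (lambda : R[i]), lambda != 0 ->
   let P := lambda *: 'X^n in
   let Q := conj_reciprocal n P in
   forall (r : R) (z : R[i]), 1 <= r -> 1 <= `|z| ->
     `|r%:C * P^`().[r%:C * z] - P^`().[z]|
       + `|r%:C * Q^`().[r%:C * z] - Q^`().[z]|
     = n%:R * (r%:C ^+ n - 1) * `|z| ^+ n.-1 * (circle_max P)%:C).
Proof.
split=> [P sP Q r z r1 z1|lambda l0 P Q r z r1 z1].
  apply: dilation_deriv_pair_le z1; first by rewrite sP.
  - exact: size_conj_reciprocal.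
  - exact: coef_conj_reciprocal.
  - exact: (circle_max_attained P).2.
  - by rewrite lecR.
have [[w w1 wM] _] := circle_max_attained P.
have -> : (circle_max P)%:C = `|lambda|.
  by rewrite -wM hornerZ hornerXn normrM normrX w1 expr1n mulr1.
(* The conjugate reciprocal of a monomial of full degree is constant, so the
   second term vanishes. *)
have Q0 : Q = (Num.conj lambda)%:P.
  rewrite /Q /conj_reciprocal big_ord_recr big1 => [|k _] /=.
    by rewrite coefZ coefXn eqxx mulr1 subnn expr0 add0r alg_polyC.
  by rewrite coefZ coefXn (ltn_eqF (ltn_ord k)) mulr0 rmorph0 scale0r.
have rn : 0 <= r%:C ^+ n - 1 :> R[i] by rewrite subr_ge0 exprn_ege1 // lecR.
rewrite Q0 derivC !horner0 mulr0 subrr normr0 addr0.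
rewrite dilation_deriv_monomial //.
by rewrite !normrM normrX normr_nat (ger0_norm rn).
Qed.
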